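(* Let $r\ge 1$ be an integer. 1. Given a $2$-regular $(K_b,f_b,Z_b,\mathcal{S}_b)$ PDA, there exists a $2^r$-regular $(2^rK_b,\;2^rf_b,\;(2^r-r-1)f_b+rZ_b,\;(2+2r)|\mathcal{S}_b|+K_bZ_b)$ PDA. 2. For coded caching with $K$ users (and $N$ files), if $2^r\mid K$, then the memory-rate pair $$(M,R)=\Big(\tfrac{N}{K}\big(K(1-2^{-r}(r+1))+r\big),\;2^{-2r}K(r+1)-2^{-r}r\Big)$$ is achievable with linear subpacketization.
   Context: Notation: $[n]=\{0,1,\dots,n-1\}$. For positive integers $K,f$, a nonnegative integer $Z$ and a finite set $\mathcal{S}$ of integers, a $(K,f,Z,\mathcal{S})$ placement delivery array (PDA) is an $f\times K$ array $P=[p_{j,k}]$ with entries in $\mathcal{S}\cup\{\ast\}$ such that: (C1) $\ast$ appears exactly $Z$ times in each column; (C2) each $s\in\mathcal{S}$ occurs at least once; (C3, Blackburn property) if two distinct cells $(j_1,k_1)$, $(j_2,k_2)$ contain the same integer then $p_{j_1,k_2}=p_{j_2,k_1}=\ast$. It is $g$-regular if each integer of $\mathcal{S}$ occurs exactly $g$ times. A number $S$ in place of the set means the integer set has $S$ elements. Coded caching: a server holds $N$ files $W_0,\dots,W_{N-1}$ of $F$ bits each and is connected by an error-free multicast link to $K$ users; user $k\in[K]$ has a cache $Z_k$ of $MF$ bits. In the placement phase the caches are filled as functions of the files, without knowledge of the demands. In the delivery phase user $k$ demands a file $D_k\in[N]$; knowing $\boldsymbol{D}=(D_0,\dots,D_{K-1})$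 the server multicasts $X^{\boldsymbol{D}}$ of $RF$ bits; for every demand vector, each user $k$ must be able to recover $W_{D_k}$ from $Z_k$ and $X^{\boldsymbol{D}}$. The scheme has subpacketization $f$ if each file is split into $f$ equal-size subfiles (with $F$ a multiple of $f$) and placement and delivery operate on subfiles (caches store subfiles; transmitted packets are XORs of subfiles). The pair $(M,R)$ is achievable with linear subpacketization if such a scheme exists with $f=mK$ for a positive integer constant $m$ (not depending on $K$, $N$). It is known (Yan et al.) that a $(K,f,Z,\mathcal{S})$ PDA gives, for any $N$, such a scheme with subpacketization $f$, $M/N=Z/f$ and $R=|\mathcal{S}|/f$: user $k$ caches the $j$-th subfile of every file whenever $p_{j,k}=\ast$, and for each $s\in\mathcal{S}$ the server sends the XOR of the subfiles $W_{D_k,j}$ over all $(j,k)$ with $p_{j,k}=s$. *)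

(* Defs.v *)
From HB Require Import structures.
From mathcomp Require Import all_boot all_order all_algebra finmap.

Set Implicit Arguments.
Unset Strict Implicit.
Unset Printing Implicit Defensive.

Import GRing.Theory.
Local Open Scope ring_scope.

(* [None] is the star; rows are indexed by subpackets, columns by users. *)
Record is_pda (K f Z : nat) (S : {fset int}) (P : 'M[option int]_(f, K)) :
    Prop := IsPDA {
  pda_K_gt0 : (0 < K)%N;
  pda_f_gt0 : (0 < f)%N;
  pda_entries : forall j k s, P j k = Some s -> s \in S;
  pda_stars : forall k, #|[set j | P j k == None]| = Z;
  pda_occurs : forall s, s \in S -> exists j k, P j k = Some s;
  pda_blackburn : forall j1 k1 j2 k2 s, (j1, k1) <> (j2, k2) ->
    P j1 k1 = Some s -> P j2 k2 = Some s ->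
    P j1 k2 = None /\ P j2 k1 = None
}.

Definition pda_regular (g K f : nat) (S : {fset int})
    (P : 'M[option int]_(f, K)) : Prop :=
  forall s, s \in S -> #|[set jk : 'I_f * 'I_K | P jk.1 jk.2 == Some s]| = g.

(* [N] files of [F] bits, one per row; bits live in 'F_2, so that addition of
   bit vectors is XOR. *)
Definition library (N F : nat) : Type := 'M['F_2]_(N, F).

Definition demand (K N : nat) : Type := {ffun 'I_K -> 'I_N}.

(* [C] is the size in bits of each cache and [T] that of the transmission.
   The demand vector is public: decoders may depend on it. *)
Record caching_scheme (K N F C T : nat) := CachingScheme {
  cache : 'I_K -> library N F -> 'rV['F_2]_C;
  transmit : demand K N -> library N F -> 'rV['F_2]_T;
  decode : 'I_K -> demand K N -> 'rV['F_2]_C -> 'rV['F_2]_T -> 'rV['F_2]_F;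
  decodeP : forall (D : demand K N) (W : library N F) (k : 'I_K),
    decode k D (cache k W) (transmit D W) = row (D k) W
}.

(* The subfile [x.2] of the file [x.1], each file of [f * b] bits being cut
   into [f] consecutive blocks of [b] bits. *)
Definition subfile (N f b : nat) (W : library N (f * b)) (x : 'I_N * 'I_f) :
    'rV['F_2]_b :=
  row x.2 (vec_mx (row x.1 W)).

(* Every cache is the concatenation of [p] distinct subfiles, and every
   transmission that of [s] packets, each one the XOR of a set of subfiles;
   which ones does not depend on the contents of the files. *)
Definition subpacketized (K N f b p s : nat)
    (A : caching_scheme K N (f * b) (p * b) (s * b)) : Prop :=
  (forall k : 'I_K, exists2 idx : 'I_p -> 'I_N * 'I_f, injective idx &
     forall W, cache A k W = mxvec (\matrix_(i < p) subfile W (idx i)))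
  /\
  (forall D : demand K N, exists pk : 'I_s -> {set 'I_N * 'I_f},
     forall W, transmit A D W =
       mxvec (\matrix_(i < s) \sum_(x in pk i) subfile W x)).

(* [M] and [R] are normalized by the file size, which ranges over all the
   positive multiples [f * b] of [f]. *)
Definition achievable_with (K N f : nat) (M R : rat) : Prop :=
  (0 < f)%N /\
  forall b : nat, (0 < b)%N ->
  exists (p s : nat) (A : caching_scheme K N (f * b) (p * b) (s * b)),
    [/\ subpacketized A,
        (p * b)%:R = M * (f * b)%:R &
        (s * b)%:R = R * (f * b)%:R].

(* Main.v *)
(** Index 2^r copies of the base array by the vertices of the hypercube
    {0,1}^r.  The block in row y and column x consists of stars when x and y
    are at distance at least 2, has the stars of the base array at distance 1,
    and is entirely filled when x = y.  The former stars of the diagonal blocks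
    each get a symbol of their own, repeated along the 2^r diagonal blocks.  If
    s is a base symbol, with its two occurrences numbered 0 and 1, then
    occurrence i in the diagonal block y becomes (s, parity y + i), and either
    occurrence in the block (y, x) with y = x + e_t becomes (s, t, y_t).  Two
    cells with the same symbol are then always separated: if they come from the
    same base cell, the crossing blocks are at distance at least 2; otherwise
    the crossing blocks are off the diagonal and the base array has stars there.

    The memory-rate pair comes from the n x n base array, n = K / 2^r, whose
    (j, k) entry is the unordered pair {j, k}, with stars on the diagonal. *)
Require Import Defs.
From HB Require Import structures.
From mathcomp Require Import all_boot all_order all_algebra finmap.
From mathcomp Require Import zify ring.

Set Implicit Arguments.
Unset Strict Implicit.
Unset Printing Implicit Defensive.

Import GRing.Theory.
Local Open Scope ring_scope.

(** * Arrays over finite types, and their exchange with integer PDAs *)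

(* Only one of the two stars of the Blackburn property is required: the other
   follows by exchanging the two cells. *)
Record fin_pda (R C L : finType) (g Z : nat) (p : R -> C -> option L) : Prop :=
  FinPDA {
  fin_stars : forall c, #|[set a | p a c == None]| = Z;
  fin_regular : forall l, #|[set ac : R * C | p ac.1 ac.2 == Some l]| = g;
  fin_blackburn : forall a1 c1 a2 c2 l, (a1, c1) <> (a2, c2) ->
    p a1 c1 = Some l -> p a2 c2 = Some l -> p a1 c2 = None
}.

(** Since all entries lie in [S], [insub] never fails and creates no new star. *)
Lemma fin_pda_of_is_pda (K f Z g : nat) (S : {fset int})
    (P : 'M[option int]_(f, K)) :
  is_pda Z S P -> pda_regular g S P ->
  fin_pda g Z (fun j k => obind (insub : int -> option S) (P j k)).
Proof.
move=> [_ _ entP starP _ bbP] regP.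
have noneE j k : (obind (insub : int -> option S) (P j k) == None)
                 = (P j k == None).
  case E: (P j k) => [s|] //=.
  by rewrite (insubT (fun s => s \in S) (entP _ _ _ E)).
have someE j k (l : S) : (obind (insub : int -> option S) (P j k) == Some l)
                 = (P j k == Some (val l)).
  case E: (P j k) => [s|] //=.
  by rewrite (insubT (fun s => s \in S) (entP _ _ _ E)) /=.
split=> [k|l|j1 k1 j2 k2 l ne /eqP e1 /eqP e2].
- by rewrite -(starP k); apply: eq_card => j; rewrite !inE noneE.
- by rewrite -(regP _ (valP l)); apply: eq_card => jk; rewrite !inE someE.
- rewrite !someE in e1 e2; apply/eqP; rewrite noneE.
  by case: (bbP _ _ _ _ _ ne (eqP e1) (eqP e2)) => ->.
Qed.

(** Labels become integers through their rank. As [g] is positive, every label occurs, as a PDA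
    requires. [f] and [K] are variables equated to cardinals, which avoids casts of the matrix
    dimensions. *)
Lemma is_pda_of_fin_pda (R C L : finType) (g Z f K : nat)
    (p : R -> C -> option L) :
  fin_pda g Z p -> (0 < g)%N -> (0 < f)%N -> (0 < K)%N ->
  f = #|R| -> K = #|C| ->
  exists (S : {fset int}) (P : 'M[option int]_(f, K)),
    [/\ is_pda Z S P, pda_regular g S P & #|` S| = #|L|].
Proof.
move=> [starP regP bbP] g0 f0 K0 ef eK; subst f K.
pose lab (l : L) : int := (enum_rank l)%:Z.
have lab_inj : injective lab by move=> l1 l2 [] /ord_inj /enum_rank_inj.
pose S := [fset lab l | l in L]%fset.
pose P : 'M[option int]_(#|R|, #|C|) :=
  \matrix_(i, j) omap lab (p (enum_val i) (enum_val j)).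
have noneE i j : (P i j == None) = (p (enum_val i) (enum_val j) == None).
  by rewrite mxE; case: (p _ _).
have someE i j l : (P i j == Some (lab l))
                   = (p (enum_val i) (enum_val j) == Some l).
  rewrite mxE; case: (p _ _) => //= l'.
  by apply/eqP/eqP => [/Some_inj/lab_inj ->|[->]].
have regPS : pda_regular g S P.
  move=> s /imfsetP[l _ ->]; rewrite -(regP l).
  pose h (ij : 'I_#|R| * 'I_#|C|) : R * C := (enum_val ij.1, enum_val ij.2).
  have h_inj : injective h.
    by move=> [i j] [i' j'] [/enum_val_inj -> /enum_val_inj ->].
  rewrite -(card_imset _ h_inj); apply: eq_card => [[a c]].
  rewrite inE /=; apply/imsetP/idP => [[[i j] ] | e].
    by rewrite inE /= someE => /[swap] -[-> ->].
  exists (enum_rank a, enum_rank c); last by rewrite /h /= !enum_rankK.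
  by rewrite inE /= someE !enum_rankK.
exists S, P; split => //; last first.
  by rewrite card_imfset // -cardE.
split=> //.
- move=> i j s; rewrite mxE; case: (p _ _) => //= l [<-].
  by apply/imfsetP; exists l.
- move=> j; rewrite -(starP (enum_val j)) -(card_imset _ enum_val_inj).
  apply: eq_card => a; rewrite inE; apply/imsetP/idP => [[i]|e].
    by rewrite inE noneE => /[swap] ->.
  by exists (enum_rank a); rewrite ?inE ?noneE enum_rankK.
- move=> s sS; have : (0 < #|[set jk | P jk.1 jk.2 == Some s]|)%N.
    by rewrite regPS.
  by case/card_gt0P=> -[i j]; rewrite inE => /eqP; exists i, j.
- have bb i1 j1 i2 j2 l : (i1, j1) <> (i2, j2) -> P i1 j1 == Some (lab l) ->
      P i2 j2 == Some (lab l) -> P i1 j2 = None.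
    rewrite !someE => ne /eqP e1 /eqP e2; apply/eqP; rewrite noneE; apply/eqP.
    by apply: bbP e1 e2 => -[/enum_val_inj ei /enum_val_inj ej]; rewrite ei ej in ne.
  move=> i1 j1 i2 j2 s ne e1 e2.
  have [l es] : exists l, s = lab l.
    by move: e1; rewrite mxE; case: (p _ _) => //= l [<-]; exists l.
  subst s; split; first by apply: bb ne _ _; apply/eqP; eassumption.
  by apply: (bb i2 j2 i1 j1 l); [exact: nesym | apply/eqP | apply/eqP].
Qed.

(** * The hypercube: bit flips, parity and neighbours *)

Section Hypercube.
Variable r : nat.
Definition cube := {ffun 'I_r -> bool}.
Implicit Types (x y : cube) (t u : 'I_r).

Definition set_bit t (b : bool) x : cube :=
  [ffun u => if u == t then b else x u].
Definition flip t x : cube := set_bit t (~~ x t) x.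
Definition parity x : bool := \big[addb/false]_t x t.

Lemma set_bitE t b x : set_bit t b x t = b.
Proof. by rewrite ffunE eqxx. Qed.

Lemma set_bit_set t b c x : set_bit t b (set_bit t c x) = set_bit t b x.
Proof. by apply/ffunP=> u; rewrite !ffunE; case: eqP. Qed.

Lemma set_bit_id t x : set_bit t (x t) x = x.
Proof. by apply/ffunP=> u; rewrite !ffunE; case: eqP => [->|]. Qed.

Lemma flipE t x : flip t x t = ~~ x t.
Proof. exact: set_bitE. Qed.

Lemma flipK t : involutive (flip t).
Proof. by move=> x; rewrite {1}/flip flipE negbK set_bit_set set_bit_id. Qed.

Lemma flip_neq t x : flip t x != x.
Proof. by apply/eqP=> /ffunP/(_ t); rewrite flipE; case: (x t). Qed.

Lemma flip_neqE t u x : u != t -> flip t x u = x u.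
Proof. by rewrite ffunE => /negPf ->. Qed.

Lemma flip_inj x : injective (flip^~ x).
Proof.
move=> t u e; apply/eqP; apply: contraT => ne.
by move/ffunP/(_ t): e; rewrite flipE flip_neqE //; case: (x t).
Qed.

Lemma parity_flip t x : parity (flip t x) = ~~ parity x.
Proof.
rewrite /parity (bigD1 t) //= [in RHS](bigD1 t) //= flipE addNb; congr (~~ (_ (+) _)).
by apply: eq_bigr => u ne; rewrite flip_neqE.
Qed.

Lemma card_cube : #|cube| = (2 ^ r)%N.
Proof. by rewrite card_ffun card_bool card_ord. Qed.

Lemma card_neighbours x : #|[set y | [exists t, y == flip t x]]| = r.
Proof.
rewrite -[RHS]card_ord -(card_imset _ (@flip_inj x)).
apply: eq_card => y; rewrite inE.
apply/existsP/imsetP => [[t /eqP ->]|[t _ ->]]; by exists t.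
Qed.

(** The ends of an edge determine its direction, so the [pick] in [lift] never has more than one
    candidate. *)
Lemma pick_flip t x : [pick u | flip t x == flip u x] = Some t.
Proof.
by case: pickP => [u /eqP /flip_inj -> //|/(_ t)]; rewrite eqxx.
Qed.

End Hypercube.

(** * Lifting a 2-regular array along the hypercube *)

Lemma two_regular_occurrences (R C L : finType) (Z : nat)
    (p : R -> C -> option L) :
  fin_pda 2 Z p ->
  exists o : L -> bool -> R * C, (forall l, injective (o l)) /\
    forall l a c, p a c = Some l <-> exists b, (a, c) = o l b.
Proof.
move=> [_ regP _].
pose Q l (h : bool -> R * C) := injective h /\
    forall a c, p a c = Some l <-> exists b, (a, c) = h b.
(* Each label is treated separately; finiteness of [L] then assembles the numberings into one
   function [o]. *)
suff /(@fin_all_exists L (fun=> bool -> R * C) Q)[o oP] l : exists h, Q l h.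
  by exists o; split=> l; case: (oP l).
have /eqP/cards2P[ac1 [ac2 [ne eS]]] := regP l.
exists (fun b : bool => if b then ac2 else ac1); split.
  by case=> -[] // e; rewrite e eqxx in ne.
move=> a c; move/setP/(_ (a, c)): eS.
rewrite !inE /= => e; split=> [/eqP|[b eb]].
  by rewrite e => /orP[]/eqP->; [exists false | exists true].
by apply/eqP; rewrite e eb; case: b {eb}; rewrite eqxx ?orbT.
Qed.

Section Lift.
Variables (r : nat) (R C L : finType) (Z : nat) (p : R -> C -> option L).
Hypothesis pdaP : fin_pda 2 Z p.
Variable o : L -> bool -> R * C.
Hypothesis o_inj : forall l, injective (o l).
Hypothesis oP : forall l a c, p a c = Some l <-> exists b, (a, c) = o l b.

Definition star_cell := {ac : R * C | p ac.1 ac.2 == None}.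
(** Each base symbol yields 2 diagonal labels and [2 * r] edge labels, and each base star one more,
    whence the size of the new symbol set. *)
Definition lift_label : finType := (L * (bool + 'I_r * bool) + star_cell)%type.

(* [o l] lists the two occurrences of [l]; [side l] inverts it. *)
Definition side (l : L) (ac : R * C) : bool := ac == o l true.

Lemma sideE l b : side l (o l b) = b.
Proof. by rewrite /side (inj_eq (@o_inj l)); case: b. Qed.

Lemma side_inj l a c a' c' : p a c = Some l -> p a' c' = Some l ->
  side l (a, c) = side l (a', c') -> (a, c) = (a', c').
Proof. by move=> /oP[b ->] /oP[b' ->]; rewrite !sideE => ->. Qed.

(** The [insub] succeeds wherever it is reached, since [p a c] is [None] there; diagonal blocks thus
    contain no star. *)
Definition lift (ya : cube r * R) (xc : cube r * C) : option lift_label :=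
  let: (y, a) := ya in let: (x, c) := xc in
  if y == x then
    if p a c is Some l then Some (inl (l, inl (parity y (+) side l (a, c))))
    else omap inr (insub (a, c) : option star_cell)
  else if [pick t | y == flip t x] is Some t then
    omap (fun l => inl (l, inr (t, y t))) (p a c)
  else None.

(** With [lift_diag] and [lift_edge], this inverts [lift] label by label, so that the Blackburn
    property and the regularity can be proved without unfolding it. *)
Lemma lift_diag_star y a x c (z : star_cell) :
  lift (y, a) (x, c) = Some (inr z) <-> y = x /\ (a, c) = val z.
Proof.
rewrite /=; split=> [|[<-]]; last first.
  case: z => -[a' c'] /= H [-> ->]; rewrite eqxx {1}(eqP H).
  by rewrite (insubT (fun ac => p ac.1 ac.2 == None) (x := (a', c')) H).
case: (y =P x) => [->|_]; last by case: pickP => // t _; case: (p a c).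
case: (p a c) => // ; case: insubP => //= u _ e [<-]; by rewrite e.
Qed.

Lemma lift_diag y a x c l b :
  lift (y, a) (x, c) = Some (inl (l, inl b)) <->
  [/\ y = x, p a c = Some l & parity y (+) side l (a, c) = b].
Proof.
rewrite /=; split=> [|[<- -> <-]]; last by rewrite eqxx.
case: (y =P x) => [->|_]; last by case: pickP => // t _; case: (p a c).
by case: (p a c) => [l' [-> <-]//|]; case: insubP.
Qed.

Lemma lift_edge y a x c l t b :
  lift (y, a) (x, c) = Some (inl (l, inr (t, b))) <->
  [/\ y = flip t x, p a c = Some l & y t = b].
Proof.
rewrite /=; split=> [|[-> -> <-]]; last first.
  by rewrite (negPf (flip_neq _ _)) pick_flip.
case: (y =P x) => [_|_].
  by case: (p a c) => //; case: insubP.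
by case: pickP => // u /eqP ->; case: (p a c) => //= l' [-> -> <-].
Qed.

Lemma lift_far y a x c : y <> x -> (forall t, y <> flip t x) ->
  lift (y, a) (x, c) = None.
Proof.
move=> /eqP/negPf /= -> far.
by case: pickP => // t /eqP /far.
Qed.

Lemma lift_off_diag y a x c : y <> x -> p a c = None ->
  lift (y, a) (x, c) = None.
Proof. by move=> /eqP/negPf /= -> ->; case: pickP. Qed.

Lemma lift_blackburn ya1 xc1 ya2 xc2 l : (ya1, xc1) <> (ya2, xc2) ->
  lift ya1 xc1 = Some l -> lift ya2 xc2 = Some l -> lift ya1 xc2 = None.
Proof.
have bbP := fin_blackburn pdaP.
case: ya1 xc1 ya2 xc2 => [y a] [x c] [y' a'] [x' c'].
case: l => [[l [b|[t b]]]|z] ne.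
- move=> /lift_diag[? pac sb] /lift_diag[? pac' sb']; subst x x' b.
  (* For the same base cell, the two vertices are distinct of equal parity, hence at distance at
     least 2. For different base cells the sides differ, so the parities do too, and the crossing
     block is off the diagonal. *)
  case: (altP ((a, c) =P (a', c'))) => [[? ?]|/eqP nac].
    subst a' c'; apply: lift_far => [e|t e]; first by rewrite e in ne.
    by move: sb'; rewrite e parity_flip; case: (parity y'); case: (side _ _).
  apply: lift_off_diag; last exact: bbP nac pac pac'.
  move=> e; subst y'; apply/nac/(side_inj pac pac').
  by move: sb'; case: (parity y); do 2 case: (side _ _).
- move=> /lift_edge[ex pac sb] /lift_edge[ex' pac' sb'].
  (* Bit [t] is [b] in both rows [y], [y'] and its negation in both columns, so no crossing block is
     diagonal. *)
  have yx' : y <> x'.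
    by move=> e; move: sb'; rewrite ex' flipE -e sb; case: b {sb}.
  case: (altP ((a, c) =P (a', c'))) => [[? ?]|/eqP nac]; last first.
    by apply: lift_off_diag yx' _; exact: bbP nac pac pac'.
  subst a' c'; apply: lift_far => // u e.
  (* An edge from [y] to [x'] would have direction [t], as they differ at bit [t]; but then [x = x']
     and the two cells coincide. *)
  have [eu|tu] := eqVneq t u.
    apply: ne; have exx : x = x' by rewrite -(flipK t x) -ex e eu flipK.
    by rewrite ex ex' exx.
  move: sb sb'; rewrite e ex' flipE flip_neqE // => ->; by case: b.
- move=> /lift_diag_star[? ez] /lift_diag_star[? ez']; subst x x'.
  move: ez'; rewrite -ez => -[? ?]; subst a' c'.
  apply: lift_off_diag => [e|]; first by rewrite e in ne.
  by have := valP z; rewrite -ez => /eqP.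
Qed.

(** In each case an injection [h] from the vertices of the cube enumerates the cells that carry the
    label. *)
Lemma lift_regular l : #|[set yx | lift yx.1 yx.2 == Some l]| = (2 ^ r)%N.
Proof.
rewrite -card_cube -cardsT.
case: l => [[l [b|[t b]]]|z].
- pose h (y : cube r) : (cube r * R) * (cube r * C) :=
    let ac := o l (parity y (+) b) in ((y, ac.1), (y, ac.2)).
  have h_inj : injective h by move=> y y' [].
  rewrite -(card_imset _ h_inj); apply: eq_card => -[[y a] [x c]].
  rewrite inE; apply/eqP/imsetP => [/lift_diag[<- /oP[d e] eb]|[y' _ [-> -> -> ->]]].
    by exists y => //; rewrite /h -eb e sideE addKb -e.
  apply/lift_diag; rewrite -surjective_pairing; split=> //.
    by apply/oP; exists (parity y' (+) b); rewrite -surjective_pairing.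
  by rewrite sideE addKb.
(* The row [y] must have bit [t] equal to [b], so bit [t] of [z] is free to select which occurrence
   of [l] is used. *)
- pose h (z : cube r) : (cube r * R) * (cube r * C) :=
    let y := set_bit t b z in let ac := o l (z t) in
    ((y, ac.1), (flip t y, ac.2)).
  have hK : cancel h (fun yx => set_bit t (side l (yx.1.2, yx.2.2)) yx.1.1).
    by move=> z /=; rewrite -surjective_pairing sideE set_bit_set set_bit_id.
  rewrite -(card_imset _ (can_inj hK)); apply: eq_card => -[[y a] [x c]].
  rewrite inE; apply/eqP/imsetP => [/lift_edge[ey /oP[d e] yt]|[z _ [-> -> -> ->]]].
    exists (set_bit t d y) => //.
    by rewrite /h set_bitE set_bit_set -yt set_bit_id -e ey flipK.
  apply/lift_edge; rewrite flipK set_bitE; split=> //.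
  by apply/oP; exists (z t); rewrite -surjective_pairing.
- pose h (y : cube r) : (cube r * R) * (cube r * C) :=
    ((y, (val z).1), (y, (val z).2)).
  have h_inj : injective h by move=> y y' [].
  rewrite -(card_imset _ h_inj); apply: eq_card => -[[y a] [x c]].
  rewrite inE; apply/eqP/imsetP => [/lift_diag_star[<- e]|[y' _ [-> -> -> ->]]].
    by exists y => //; rewrite /h -e.
  by apply/lift_diag_star; rewrite -surjective_pairing.
Qed.

(** Over a column of block [x], the diagonal block gives no star, each of the [r] neighbours gives
    [Z], and each remaining vertex a full column of [#|R|]. *)
Lemma lift_stars xc :
  #|[set ya | lift ya xc == None]| = ((2 ^ r - r - 1) * #|R| + r * Z)%N.
Proof.
case: xc => x c.
pose N := [set y | [exists t, y == flip t x]].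
have xN : x \notin N.
  by rewrite inE; apply/existsP=> -[t /eqP e]; have := flip_neq t x; rewrite -e eqxx.
have cardN : #|N| = r := card_neighbours x.
have -> : #|[set ya | lift ya (x, c) == None]|
    = (\sum_(y : cube r) #|[set a | lift (y, a) (x, c) == None]|)%N.
  rewrite -sum1dep_card (eq_bigr (fun y => \sum_(a | lift (y, a) (x, c) == None) 1)%N).
    by rewrite pair_big_dep /=; apply: eq_bigl => -[].
  by move=> y _; rewrite sum1dep_card.
have starsE y : #|[set a | lift (y, a) (x, c) == None]|
    = (if y == x then 0 else if y \in N then Z else #|R|)%N.
  have [->|/eqP yx] := eqVneq y x.
    apply: eq_card0 => a; rewrite !inE /= eqxx.
    case E: (p a c) => [l|] //; by rewrite insubT ?E.
  rewrite -(fin_stars pdaP c) inE.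
  case: ifP => [/existsP[t /eqP ey]|/existsP far].
    apply: eq_card => a; rewrite !inE; case E: (p a c) => [l|].
      by apply/eqP; rewrite (lift_edge y a x c l t (y t)).2.
    by rewrite (lift_off_diag yx E).
  rewrite -cardsT; apply: eq_card => a; rewrite !inE.
  by rewrite lift_far // => t ey; apply: far; exists t; rewrite ey.
rewrite (eq_bigr _ (fun y _ => starsE y)) (bigD1 x) //= eqxx add0n.
rewrite (eq_bigr (fun y => if y \in N then Z else #|R|)); last first.
  by move=> y /negPf ->.
rewrite (bigID (mem N)) /=.
rewrite (eq_bigr (fun=> Z)) => [|y /andP[_ ->] //].
rewrite [X in (_ + X)%N](eq_bigr (fun=> #|R|)) => [|y /andP[_ /negPf ->] //].
rewrite !sum_nat_const.
have -> : #|[pred y | (y != x) && (y \in N)]| = r.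
  rewrite -[RHS]cardN; apply: eq_card => y; rewrite !inE.
  by have [->|//] := eqVneq y x; rewrite inE in xN; rewrite (negPf xN).
have -> : #|[pred y | (y != x) && (y \notin N)]| = (2 ^ r - r - 1)%N.
  transitivity #|~: (x |: N)|.
    by apply: eq_card => y; rewrite !inE negb_or.
  by rewrite cardsCs setCK card_cube cardsU1 xN cardN; lia.
by rewrite addnC.
Qed.

End Lift.

Lemma card_star_cells (R C L : finType) (g Z : nat) (p : R -> C -> option L) :
  fin_pda g Z p -> #|{: star_cell p}| = (#|C| * Z)%N.
Proof.
move=> [starP _ _]; rewrite card_sig.
transitivity (\sum_(c : C) #|[set a | p a c == None]|)%N.
  rewrite -sum1_card (eq_bigr (fun c => \sum_(a | p a c == None) 1)%N).
    rewrite (exchange_big_dep xpredT) //= pair_big_dep /=.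
    by apply: eq_bigl => -[a c]; rewrite !inE.
  by move=> c _; rewrite sum1dep_card.
by rewrite (eq_bigr _ (fun c _ => starP c)) sum_nat_const.
Qed.

Lemma lift_pda (r Kb fb Zb : nat) (Sb : {fset int})
    (Pb : 'M[option int]_(fb, Kb)) :
  is_pda Zb Sb Pb -> pda_regular 2 Sb Pb ->
  exists (S : {fset int}) (P : 'M[option int]_(2 ^ r * fb, 2 ^ r * Kb)),
    [/\ is_pda ((2 ^ r - r - 1) * fb + r * Zb) S P,
        pda_regular (2 ^ r) S P &
        #|` S| = ((2 + 2 * r) * #|` Sb| + Kb * Zb)%N].
Proof.
move=> pdaP regP; have finP := fin_pda_of_is_pda pdaP regP.
have [o [o_inj oP]] := two_regular_occurrences finP.
set p := (fun j k => _) in finP oP.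
have liftP : fin_pda (2 ^ r) ((2 ^ r - r - 1) * fb + r * Zb) (lift (r := r) p o).
  split; first by move=> xc; rewrite (lift_stars finP) // card_ord.
    exact: lift_regular.
  by move=> a1 c1 a2 c2 l; exact: (lift_blackburn finP o_inj oP).
have r2 : (0 < 2 ^ r)%N by rewrite expn_gt0.
have [||||S [P [PP PR PS]]] := is_pda_of_fin_pda
  (f := (2 ^ r * fb)%N) (K := (2 ^ r * Kb)%N) liftP r2.
- by rewrite muln_gt0 r2 (pda_f_gt0 pdaP).
- by rewrite muln_gt0 r2 (pda_K_gt0 pdaP).
- by rewrite card_prod card_cube card_ord.
- by rewrite card_prod card_cube card_ord.
exists S, P; split=> //; rewrite PS card_sum (card_star_cells finP) !card_prod.
by rewrite card_sum card_prod card_bool !card_ord cardfE; ring.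
Qed.

(** * The base array of unordered pairs *)

Lemma pairs_pda (n : nat) : (0 < n)%N ->
  exists (S : {fset int}) (P : 'M[option int]_(n, n)),
    [/\ is_pda 1 S P, pda_regular 2 S P & #|` S| = 'C(n, 2)].
Proof.
move=> n0; pose L : finType := {A : {set 'I_n} | #|A| == 2%N}.
pose p (j k : 'I_n) : option L := insub [set j; k].
have pE j k l : p j k = Some l <-> [set j; k] = val l.
  split=> [|e]; first by rewrite /p; case: insubP => // u _ <- [->].
  by rewrite /p e valK.
have noneE j k : (p j k == None) = (j == k).
  rewrite /p; have [->|ne] := eqVneq j k; first by rewrite insubN ?cards2 ?eqxx.
  by rewrite insubT ?cards2 ?ne.
have pP : fin_pda 2 1 p.
  split=> [k|l|j1 k1 j2 k2 l ne /pE e1 /pE e2].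
  - rewrite -(cards1 k); apply: eq_card => j; by rewrite !inE noneE.
  - have /cards2P[u [v [uv e]]] := valP l.
    have <- : #|[set (u, v); (v, u)]| = 2%N.
      by rewrite cards2 xpair_eqE negb_and uv.
    apply: eq_card => -[j k]; rewrite !inE !xpair_eqE.
    apply/eqP/idP => [/pE|].
      rewrite e => E; have jk : j != k.
        by have := valP l; rewrite e -E cards2; case: (j != k).
      have := jk; have := set21 j k; have := set22 j k; rewrite E !inE.
      by move=> /orP[] /eqP -> /orP[] /eqP ->; rewrite ?eqxx ?orbT.
    by case/orP=> /andP[/eqP-> /eqP->]; apply/pE; rewrite e // setUC.
  (* Distinct cells with the same pair are transposes of each other, so they cross on the
     diagonal. *)
  - apply/eqP; rewrite noneE.
    have jk : j1 != k1 by have := valP l; rewrite -e1 cards2; case: (j1 != k1).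
    have := ne; have := jk; have := set21 j1 k1; have := set22 j1 k1.
    by rewrite e1 -e2 !inE => /orP[] /eqP -> /orP[] /eqP ->; rewrite ?eqxx.
have [||S [P [PP PR PS]]] := is_pda_of_fin_pda (f := n) (K := n) pP isT n0 n0.
- by rewrite card_ord.
- by rewrite card_ord.
exists S, P; split=> //; rewrite PS card_sig.
by rewrite -[n in 'C(n, 2)]card_ord -card_draws; apply: eq_card => A; rewrite !inE.
Qed.

(** * From a PDA to a coded caching scheme *)

Lemma subfile_inj (N f b : nat) (W W' : library N (f * b)) n :
  (forall j, subfile W (n, j) = subfile W' (n, j)) -> row n W = row n W'.
Proof.
move=> e; rewrite -[row n W]vec_mxK -[row n W']vec_mxK; congr mxvec.
by apply/row_matrixP=> j; exact: e.
Qed.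

(** In the packet of [s = P j k], user [k] lacks only its own subfile: the Blackburn property puts a
    star of column [k] in the row of every other cell of [s]. *)
Lemma achievable_of_pda (K N f Z : nat) (S : {fset int})
    (P : 'M[option int]_(f, K)) :
  is_pda Z S P ->
  achievable_with K N f (N%:R * Z%:R / f%:R) (#|` S|%:R / f%:R).
Proof.
move=> [K0 f0 entP starP _ bbP]; split=> // b b0.
pose cached (k : 'I_K) : {set 'I_N * 'I_f} := [set x | P x.2 k == None].
have cardC k : #|cached k| = (N * Z)%N.
  rewrite -(starP k) -[N in RHS]card_ord -cardsT -cardsX.
  by apply: eq_card => -[n j]; rewrite !inE.
pose idx k (i : 'I_(N * Z)) := enum_val (cast_ord (esym (cardC k)) i).
(* The cells of one integer lie in distinct rows, so this image merges no two of them. *)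
pose packet (D : demand K N) (i : 'I_#|` S|) : {set 'I_N * 'I_f} :=
  [set (D jk.2, jk.1) | jk in [set jk : 'I_f * 'I_K |
    P jk.1 jk.2 == Some (nth 0 S i)]].
pose ca k (W : library N (f * b)) : 'rV['F_2]_(N * Z * b) :=
  mxvec (\matrix_(i < N * Z) subfile W (idx k i)).
pose tr D (W : library N (f * b)) : 'rV['F_2]_(#|` S| * b) :=
  mxvec (\matrix_(i < #|` S|) \sum_(x in packet D i) subfile W x).
have decodable D k W W' : ca k W = ca k W' -> tr D W = tr D W' ->
    row (D k) W = row (D k) W'.
  move=> /(can_inj mxvecK)/row_matrixP cE /(can_inj mxvecK)/row_matrixP tE.
  have cacheE n j : P j k = None -> subfile W (n, j) = subfile W' (n, j).
    move=> e; have xC : (n, j) \in cached k by rewrite inE e.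
    have := cE (cast_ord (cardC k) (enum_rank_in xC (n, j))).
    by rewrite !rowK /idx cast_ordK enum_rankK_in.
  apply: subfile_inj => j; case E: (P j k) => [s|]; last exact: cacheE.
  have sS := entP _ _ _ E.
  have lt_s : (index s S < #|` S|)%N by rewrite index_mem.
  have := tE (Ordinal lt_s); rewrite !rowK.
  have jP : (D k, j) \in packet D (Ordinal lt_s).
    by apply/imsetP; exists (j, k); rewrite // inE /= nth_index // E.
  rewrite !(big_setD1 _ jP) /=.
  (* Once the other summands are known to agree for [W] and [W'], they cancel and leave the demanded
     subfile. *)
  rewrite (eq_bigr (subfile W')) => [/addIr //|x]; rewrite !inE => /andP[ne].
  case/imsetP=> -[j' k']; rewrite inE /= nth_index // => /eqP E' ex; subst x.
  apply: cacheE; have [//|_ //] := bbP j k j' k' s _ E E'.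
  by case=> ej ek; rewrite -ej -ek eqxx in ne.
(* The decoder guesses any library compatible with what it received. *)
pose de k D c t : 'rV['F_2]_(f * b) :=
  if [pick W | (ca k W == c) && (tr D W == t)] is Some W then row (D k) W else 0.
have deP D W k : de k D (ca k W) (tr D W) = row (D k) W.
  rewrite /de; case: pickP => [W' /andP[/eqP eC /eqP eT]|/(_ W)].
    exact: decodable.
  by rewrite !eqxx.
exists (N * Z)%N, #|` S|, (CachingScheme deP).
have f_neq0 : (f%:R : rat) != 0 by rewrite Num.Theory.pnatr_eq0 -lt0n.
split.
- split=> [k|D]; last by exists (packet D).
  by exists (idx k) => // i i' /enum_val_inj/cast_ord_inj.
- by rewrite !natrM; field.
- by rewrite !natrM; field.
Qed.

Theorem theorem25 (r : nat) (r_ge1 : (1 <= r)%N) :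
  (forall (Kb fb Zb : nat) (Sb : {fset int}) (Pb : 'M[option int]_(fb, Kb)),
     is_pda Zb Sb Pb -> pda_regular 2 Sb Pb ->
     exists (S : {fset int}) (P : 'M[option int]_(2 ^ r * fb, 2 ^ r * Kb)),
       [/\ is_pda ((2 ^ r - r - 1) * fb + r * Zb) S P,
           pda_regular (2 ^ r) S P &
           #|` S| = ((2 + 2 * r) * #|` Sb| + Kb * Zb)%N])
  /\
  (exists2 m : nat, (0 < m)%N &
   forall K N : nat, (0 < K)%N -> (0 < N)%N -> (2 ^ r %| K)%N ->
     achievable_with K N (m * K)
       (N%:R / K%:R * (K%:R * (1 - 2 ^- r * (r%:R + 1)) + r%:R))
       (2 ^- (2 * r) * K%:R * (r%:R + 1) - 2 ^- r * r%:R)).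
Proof.
split=> [Kb fb Zb Sb Pb PbP PbR|]; first exact: lift_pda PbP PbR.
(* Lifting the [n] by [n] base array gives [2 ^ r * n = K] rows, so [m = 1]. *)
exists 1%N => // K N K0 N0 /dvdnP[n eK].
have n0 : (0 < n)%N by move: K0; rewrite eK muln_gt0 => /andP[].
have [Sb [Pb [PbP PbR cSb]]] := pairs_pda n0.
have [S [P [PP _ cS]]] := lift_pda r PbP PbR.
rewrite mul1n {}eK [(n * _)%N]mulnC.
have q0 : (2 ^+ r : rat) != 0 by rewrite expf_neq0 // Num.Theory.pnatr_eq0.
have n0R : (n%:R : rat) != 0 by rewrite Num.Theory.pnatr_eq0 -lt0n.
(* Ensures that the truncated subtraction in the star count agrees with the rational one. *)
have r_lt : (r + 1 <= 2 ^ r)%N by rewrite addn1 ltn_expl.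
have := achievable_of_pda N PP.
congr achievable_with.
- rewrite natrD !natrM -subnDA natrB // natrX natrD.
  by field; rewrite q0 n0R.
- have bin : 2 * 'C(n, 2)%:R = n%:R * (n%:R - 1) :> rat.
    by rewrite -natrM -mul_bin_diag bin1 natrM -subn1 natrB.
  (* Grouping the factor 2 with the binomial turns it into [n * (n - 1)] without a division. *)
  have -> : #|` S| = (r.+1 * (2 * 'C(n, 2)) + n)%N by rewrite cS cSb; ring.
  rewrite natrD !natrM bin natrX -[r.+1]addn1 natrD mulnC exprM.
  by field; rewrite q0 n0R.
Qed.
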